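(* There exists $n_0$ such that for every $n \geq n_0$ the following holds. If $\mathcal{A}, \mathcal{B} \subset S_n$ is a cross-intersecting pair of families which are not both contained within the same 1-coset, then \[\min(|\mathcal{A}|, |\mathcal{B}|) \leq (n-1)! - d_{n-1} - d_{n-2} + 1,\] with equality if and only if \[\mathcal{A} = \{\sigma \in S_n : \sigma(i) = j,\ \sigma \text{ intersects } \tau\} \cup \{\rho\}, \qquad \mathcal{B} = \{\sigma \in S_n : \sigma(i) = j,\ \sigma \text{ intersects } \rho\} \cup \{\tau\}\] for some $i, j \in [n]$ and some $\tau, \rho \in S_n$ which intersect and do not map $i$ to $j$.
   Context: $S_n$ is the symmetric group on $[n]=\{1,\ldots,n\}$. Two permutations $\sigma,\tau$ intersect if $\sigma(k)=\tau(k)$ for some $k\in[n]$. A pair of families $\mathcal{A},\mathcal{B} \subset S_n$ is cross-intersecting if every $\sigma \in \mathcal{A}$ intersects every $\tau \in \mathcal{B}$. A 1-coset of $S_n$ is a set of the form $\{\sigma \in S_n : \sigma(i)=j\}$ for some $i,j\in[n]$. $d_m$ denotes the number of derangements (fixed-point-free permutations) of an $m$-element set. *)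

(* Defs.v *)
From mathcomp Require Import all_boot all_fingroup.
Set Implicit Arguments. Unset Strict Implicit. Unset Printing Implicit Defensive.

Definition perm_intersect n (s t : {perm 'I_n}) : bool := [exists k, s k == t k].

Definition cross_intersecting n (A B : {set {perm 'I_n}}) : Prop :=
  forall s t, s \in A -> t \in B -> perm_intersect s t.

Definition one_coset n (i j : 'I_n) : {set {perm 'I_n}} := [set s : {perm 'I_n} | s i == j].

Definition derangements (m : nat) : nat :=
  #|[set s : {perm 'I_m} | [forall x, s x != x]]|.

(* Main.v *)
Require Import Defs.
From mathcomp Require Import all_boot all_fingroup all_order all_algebra.
From mathcomp Require Import zify lra ring.
Set Implicit Arguments. Unset Strict Implicit. Unset Printing Implicit Defensive.
Import Order.TTheory GRing.Theory Num.Theory.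

(** The proof is by spread approximation.  View a permutation as its graph, a set
    of n points of the n x n grid, and take r of order sqrt n.  A nonempty family
    F is spread over a core X if all its members contain X and the proportion of
    those containing a larger set Y is at most r^-(|Y| - |X|).  Maximising
    r^|X| |F(X)| shows that, up to n!/n^6 elements, every family of permutations
    is covered by cores of size at most 12.  Two families that are spread over
    disjoint cores contain disjoint permutations: colour the grid at random with
    four colours; with probability more than 1/2 the first family has a member
    (off its core) inside the first two colours, and likewise for the second
    family and the other two colours.  Hence the cores of A meet the cores of B.
    If they had no common point z, one of A and B would have size O((n-2)!).  So A
    and B lie in the 1-coset of z up to (n-6)! elements.  Two elements of B outside
    it exclude (n-6)! more permutations from A than a single one does, so a
    large pair has exactly one element of A and one of B outside. *)

(** * Counting permutations *)

Definition moved (T : finType) (s : {perm T}) : {set T} := [set x | s x != x].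

Lemma moved_subset (T : finType) (s : {perm T}) (S : {set T}) :
  (moved s \subset S) = perm_on S s.
Proof. by rewrite /perm_on; apply: eq_subset => x; rewrite !inE. Qed.

Lemma sum_card_proper (T : finType) (S : {set T}) (h : nat -> nat) :
  \sum_(U : {set T} | U \proper S) h #|U| = \sum_(j < #|S|) 'C(#|S|, j) * h j.
Proof.
case: (posnP #|S|) => [/eqP S0|Sgt0].
  rewrite big_pred0; last first.
    by move=> U; rewrite properEcard (eqP S0) ltn0 andbF.
  by rewrite (eqP S0) big_ord0.
(* A proper subset has size below [#|S|], so reduction modulo [#|S|] leaves the size unchanged and
   only makes it an ordinal. *)
rewrite (partition_big (fun U : {set T} => Ordinal (ltn_pmod #|U| Sgt0)) predT) //.
apply: eq_bigr => j _.
rewrite -[X in _ = X * _]cards_draws -[X in _ = X * _]sum1_card big_distrl /=.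
apply: eq_big => [U|U /andP[/proper_card ltU /eqP <-]]; last first.
  by rewrite mul1n /= modn_small.
rewrite !inE properEcard -andbA; case: (U \subset S) => //=.
rewrite -val_eqE /=; case: ltnP => [ltU|leU] /=; first by rewrite modn_small.
apply/esym/negbTE; apply: contraTneq (ltn_ord j) => <-; lia.
Qed.

Lemma sum_moved_subset (T : finType) (S : {set T}) :
  \sum_(U : {set T} | U \subset S) #|[set s : {perm T} | moved s == U]| = #|S|`!.
Proof.
rewrite -card_perm -[RHS]sum1_card.
rewrite (partition_big (@moved T) (fun U : {set T} => U \subset S)) /=; last first.
  by move=> s; rewrite moved_subset.
apply: eq_bigr => U sUS; rewrite -sum1_card; apply: eq_bigl => s.
rewrite inE andb_idl // => /eqP sU.
by rewrite -sU moved_subset in sUS.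
Qed.

Lemma derangementsE m :
  derangements m = #|[set s : {perm 'I_m} | moved s == [set: 'I_m]]|.
Proof.
rewrite /derangements; congr #|pred_of_set _|; apply/setP => s; rewrite !inE.
apply/forallP/eqP => [h|h x].
  by apply/setP => x; rewrite !inE h.
by have := in_setT x; rewrite -h inE.
Qed.

(* Summing over all subsets gives |S|!, so by Moebius inversion the number of
   permutations moving exactly S depends on |S| only. *)
Lemma card_moved_eq (T : finType) (S : {set T}) :
  #|[set s : {perm T} | moved s == S]| = derangements #|S|.
Proof.
have step (T1 : finType) (S1 : {set T1}) :
    (forall U : {set T1}, U \proper S1 ->
       #|[set s : {perm T1} | moved s == U]| = derangements #|U|) ->
    #|[set s : {perm T1} | moved s == S1]| +
      \sum_(j < #|S1|) 'C(#|S1|, j) * derangements j = #|S1|`!.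
  move=> IH; rewrite -sum_moved_subset (bigD1 S1) //=; congr addn.
  rewrite -sum_card_proper; apply: eq_big => [U|U]; first by rewrite properEneq andbC.
  by move=> ltU; rewrite IH.
have [k leSk] := ubnP #|S|.
elim: k => // k IHk in T S leSk *.
have IH (T1 : finType) (U : {set T1}) : #|U| < #|S| ->
    #|[set s : {perm T1} | moved s == U]| = derangements #|U|.
  by move=> ltU; apply: IHk; apply: leq_trans ltU _.
(* [S] and the full set of ['I_#|S|] satisfy the same equation with the same lower terms; for the
   full set the top term is [derangements #|S|]. *)
have h1 := step T S (fun U ltU => IH _ U (proper_card ltU)).
have h2 := step _ [set: 'I_#|S|].
rewrite cardsT card_ord -derangementsE in h2.
apply/eqP; rewrite -(eqn_add2r (\sum_(j < #|S|) 'C(#|S|, j) * derangements j)) h1.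
by rewrite h2 // => U /proper_card; rewrite cardsT card_ord; apply: IH.
Qed.

Lemma card_moved_compl (n : nat) (Q : {set 'I_n}) :
  #|[set s : {perm 'I_n} | moved s == ~: Q]| = derangements (n - #|Q|).
Proof. by rewrite card_moved_eq cardsCs setCK card_ord. Qed.

Lemma perm_intersectP n (s t : {perm 'I_n}) :
  reflect (exists k, s k = t k) (perm_intersect s t).
Proof. by apply: (iffP existsP) => -[k /eqP]; exists k. Qed.

Lemma perm_intersectC n (s t : {perm 'I_n}) : perm_intersect s t = perm_intersect t s.
Proof. by apply: eq_existsb => k; rewrite eq_sym. Qed.

Lemma perm_intersect_mulV n (s t : {perm 'I_n}) :
  perm_intersect s t = perm_intersect (s * t^-1)%g 1%g.
Proof.
apply: eq_existsb => k; rewrite permM perm1.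
by rewrite -[RHS](inj_eq (@perm_inj _ t)) permKV.
Qed.

Lemma perm_intersect1 n (s : {perm 'I_n}) :
  perm_intersect s 1 = (moved s != [set: 'I_n]).
Proof.
apply/existsP/idP => [[k /eqP]|].
  rewrite perm1 => sk; apply: contraTneq (in_setT k) => <-.
  by rewrite inE sk eqxx.
rewrite -subTset => /subsetPn[k _]; rewrite inE negbK => /eqP sk.
by exists k; rewrite perm1 sk.
Qed.

(** Composing with [tperm i j] makes a derangement with [s i = j] fix [i]. It still moves every
    other point, except that it also fixes [j] when [s j = i]; the two cases give the two
    summands. *)
Lemma card_coset_derangements n (i j : 'I_n) : i != j ->
  #|[set s : {perm 'I_n} | (s i == j) && (moved s == [set: 'I_n])]|
    = derangements n.-1 + derangements n.-2.
Proof.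
move=> nij.
have <- : #|[set s : {perm 'I_n} | moved s == ~: [set i]]| = derangements n.-1.
  by rewrite card_moved_compl cards1 subn1.
have <- : #|[set s : {perm 'I_n} | moved s == ~: [set i; j]]| = derangements n.-2.
  by rewrite card_moved_compl cards2 nij subn2.
rewrite -cardsUI [X in _ + X](_ : _ = 0) ?addn0; last first.
  apply/eqP; rewrite cards_eq0 -subset0; apply/subsetP => s; rewrite !inE.
  move=> /andP[/eqP -> /eqP /setP /(_ j)].
  by rewrite !inE eqxx orbT eq_sym nij.
have inj : injective (fun s : {perm 'I_n} => (s * tperm i j)%g) by exact: mulIg.
rewrite -(card_imset _ inj); congr #|pred_of_set _|; apply/setP => p.
rewrite -[p](mulgKV (tperm i j)) tpermV; set s := (p * tperm i j)%g.
rewrite (mem_imset _ s inj).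
have Es x : (s * tperm i j)%g x = tperm i j (s x) by rewrite permM.
have eqI (u : {perm 'I_n}) (A : {set 'I_n}) : (moved u == A) = [forall x, (u x != x) == (x \in A)].
  apply/eqP/forallP => [<- x|h]; first by rewrite inE.
  by apply/setP => x; rewrite inE (eqP (h x)).
rewrite !inE !eqI.
apply/andP/orP.
- move=> [/eqP si /forallP ms].
  have [sj|sj] := eqVneq (s j) i; [right|left]; apply/forallP => x; rewrite Es !inE.
  + have [->|nxi] := eqVneq x i; first by rewrite si tpermR eqxx.
    have [->|nxj] := eqVneq x j; first by rewrite sj tpermL eqxx.
    rewrite tpermD //=; first by have := ms x; rewrite inE.
    * by rewrite -sj (inj_eq perm_inj) eq_sym.
    * by rewrite -si (inj_eq perm_inj) eq_sym.
  + have [->|nxi] := eqVneq x i; first by rewrite si tpermR eqxx.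
    have [sx|nsx] := eqVneq (s x) i.
      rewrite sx tpermL /= eqb_id; apply: contraNneq sj => jx.
      by rewrite jx sx.
    rewrite tpermD; first by have := ms x; rewrite inE.
    * by rewrite eq_sym.
    * by rewrite -si (inj_eq perm_inj) eq_sym.
- move=> h.
  have tsi : tperm i j (s i) = i.
    by case: h => /forallP /(_ i); rewrite Es !inE eqxx /= => /eqP/negbFE/eqP.
  have si : s i = j by rewrite -[s i](tpermK i j) tsi tpermL.
  rewrite si eqxx; split => //; apply/forallP => x; rewrite inE eqb_id.
  have [->|nxi] := eqVneq x i; first by rewrite si eq_sym.
  have [sx|nsx] := eqVneq (s x) i; first by rewrite sx eq_sym.
  have tsx : tperm i j (s x) = s x.
    by rewrite tpermD // 1?eq_sym // -si (inj_eq perm_inj).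
  case: h => /forallP /(_ x); rewrite Es tsx !inE ?(negbTE nxi) /=.
    by move=> /eqP ->.
  have [->|nxj] := eqVneq x j; last by move=> /eqP ->.
  move=> /eqP/negbFE/eqP sj; move: nij; rewrite -[i == j](inj_eq (@perm_inj _ s)).
  by rewrite si sj eqxx.
Qed.

(** Right translation by [t^-1] turns disjointness from [t] into having no fixed point, and
    [s i = j] into the value [t^-1 j] at [i], which differs from [i] because [t i != j]. *)
Lemma card_coset_disjoint n (i j : 'I_n) (t : {perm 'I_n}) : t i != j ->
  #|[set s : {perm 'I_n} | (s i == j) && ~~ perm_intersect s t]|
    = derangements n.-1 + derangements n.-2.
Proof.
move=> tij; rewrite -(@card_coset_derangements n i (t^-1%g j)); last first.
  by apply: contraNneq tij => ->; rewrite permKV.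
rewrite -[RHS](card_imset _ (mulIg t)); congr #|pred_of_set _|; apply/setP => p.
rewrite -[p](mulgKV t) (mem_imset _ _ (mulIg t)) !inE permM.
rewrite perm_intersect_mulV mulgK perm_intersect1 negbK.
by rewrite -[_ == t^-1%g j](inj_eq (@perm_inj _ t)) permKV.
Qed.

Lemma card_coset n (i j : 'I_n) : #|one_coset i j| = n.-1`!.
Proof.
have -> : n.-1 = #|~: [set i]| by rewrite cardsCs setCK cards1 card_ord subn1.
rewrite -card_perm.
have e : perm_on (~: [set i]) =i [set s : {perm 'I_n} | s i == i].
  move=> s; rewrite inE unfold_in; apply/subsetP/eqP => [h|h x].
    by apply/eqP; apply: contraT => /(h i); rewrite !inE eqxx.
  by rewrite !inE; apply: contraNneq => ->; rewrite h.
rewrite (eq_card e) -[RHS](card_imset _ (mulIg (tperm i j))).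
apply: eq_card => p; rewrite -[p](mulgKV (tperm i j)) (mem_imset _ _ (mulIg _)) !inE permM.
by rewrite -[in X in _ == X](tpermL i j) (inj_eq perm_inj).
Qed.

Lemma card_coset_meet n (i j : 'I_n) (t : {perm 'I_n}) : t i != j ->
  #|[set s : {perm 'I_n} | (s i == j) && perm_intersect s t]|
    = n.-1`! - derangements n.-1 - derangements n.-2.
Proof.
move=> tij; rewrite -(card_coset i j) -subnDA -(card_coset_disjoint tij).
rewrite -(cardsID [set s | perm_intersect s t] (one_coset i j)).
rewrite (_ : one_coset i j :\: _ = [set s : {perm 'I_n} | (s i == j) && ~~ perm_intersect s t]); last first.
  by apply/setP => s; rewrite !inE andbC.
by rewrite addnK; apply: eq_card => s; rewrite !inE.
Qed.

(** Classify by the image of [ord0], which takes [m.+1] values; each class is counted by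
    [card_coset_derangements]. *)
Lemma derangements_rec m :
  derangements m.+2 = m.+1 * (derangements m.+1 + derangements m).
Proof.
rewrite derangementsE -sum1dep_card.
rewrite (partition_big (fun s : {perm 'I_m.+2} => s ord0) (fun j => j != ord0)) /=; last first.
  by move=> s /eqP/setP/(_ ord0); rewrite !inE.
have card_j : #|[pred j : 'I_m.+2 | j != ord0]| = m.+1.
  by rewrite (eq_card (B := predC1 ord0)) // cardC1 card_ord.
rewrite -[X in X * _]card_j -sum_nat_const; apply: eq_bigr => j nj0.
rewrite -[RHS](@card_coset_derangements m.+2 ord0 j) 1?eq_sym // -sum1dep_card.
by apply: eq_bigl => s; rewrite andbC.
Qed.

Lemma derangements0 : derangements 0 = 1.
Proof.
have := card_moved_eq (set0 : {set 'I_0}); rewrite cards0 => <-.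
apply/eqP/cards1P; exists 1%g.
by apply/setP => s; rewrite !inE; apply/eqP/eqP => _; [apply/permP=> -[]|apply/setP => -[]].
Qed.

Lemma derangements1 : derangements 1 = 0.
Proof.
rewrite derangementsE; apply/eqP; rewrite cards_eq0 -subset0; apply/subsetP => s.
by rewrite !inE => /eqP/setP/(_ ord0); rewrite !inE (ord1 (s _)) eqxx.
Qed.

(** The bound m!/2 passes through the recursion without loss, as (m+2)((m+2)! + (m+1)!) = (m+3)!. It
    starts at size 1 because d_0 = 1. *)
Lemma derangements_le m : (derangements m.+1).*2 <= m.+1`!.
Proof.
elim/ltn_ind: m => -[|[|m]] IH; rewrite ?derangements1 //.
  by rewrite derangements_rec derangements1 derangements0.
have h1 := IH m.+1 (ltnSn _); have h2 := IH m (leqnSn _).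
rewrite derangements_rec doubleMr doubleD.
apply: leq_trans (leq_mul (leqnn _) (leq_add h1 h2)) _.
by rewrite [m.+3`!]factS [m.+2`!]factS; nia.
Qed.

Lemma derangements_ge m : m`! <= derangements m.+2.
Proof.
elim: m => [|m IH]; first by rewrite derangements_rec derangements1 derangements0.
by rewrite factS derangements_rec; apply: leq_mul => //; apply: leq_trans IH (leq_addr _ _).
Qed.

(** The extremal size exceeds any constant multiple of (n-2)! for large n, so families of size
    O((n-2)!) are too small to matter. *)
Lemma card_coset_meet_lower n : 1 < n ->
  (n - 2) * (n - 2)`! <= (n.-1`! - derangements n.-1 - derangements n.-2).*2.
Proof.
case: n => [|[|[|n]]] // _; rewrite !subSS subn0 /=.
have h1 := derangements_le n.+1; have h2 := derangements_le n.
by rewrite [n.+2`!]factS in h1 *; nia.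
Qed.

(** * Graphs of permutations, and derangements with two prescribed values *)

Definition graph n (s : {perm 'I_n}) : {set 'I_n * 'I_n} := [set p | s p.1 == p.2].

Lemma card_graph n (s : {perm 'I_n}) : #|graph s| = n.
Proof.
rewrite -[RHS]card_ord -cardsT -(card_imset _ (f := fun i => (i, s i))); last by move=> i k [].
apply: eq_card => -[i j]; rewrite inE /=; apply/eqP/imsetP => [<-|[k _ [-> ->]]] //.
by exists i.
Qed.

(** If [s0] is one permutation through [X], then [s * s0^-1] fixes the first coordinates of [X],
    which are [#|X|] distinct points because [X] lies in a graph. *)
Lemma card_graph_superset n (X : {set 'I_n * 'I_n}) :
  #|[set s : {perm 'I_n} | X \subset graph s]| <= (n - #|X|)`!.
Proof.
case: (set_0Vmem [set s : {perm 'I_n} | X \subset graph s]) => [->|[s0]].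
  by rewrite cards0.
rewrite inE => /subsetP Xs0.
have cX : #|[set p.1 | p in X]| = #|X|.
  apply: card_in_imset => -[a b] [c d] /Xs0; rewrite inE /= => /eqP <- /Xs0.
  by rewrite inE /= => /eqP <- ->.
rewrite -cX; have -> : n - #|[set p.1 | p in X]| = #|~: [set p.1 | p in X]|.
  by rewrite [RHS]cardsCs setCK card_ord.
rewrite -card_perm -(card_imset _ (mulIg s0^-1%g)).
apply/subset_leq_card/subsetP => p /imsetP[s]; rewrite inE => /subsetP Xs ->.
rewrite unfold_in; apply/subsetP => x; rewrite !inE permM; apply: contra.
move=> /imsetP[q qX ->].
by have := Xs _ qX; have := Xs0 _ qX; rewrite !inE => /eqP <- /eqP ->; rewrite permK.
Qed.

(** According to the coincidences among the points, the partial map closes up to a transposition, a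
    3-cycle or two disjoint transpositions. Nothing else moves, which leaves the complement free for
    any derangement. *)
Lemma exists_cyclic_extension n (i j k l : 'I_n) :
  i != j -> k != l -> i != k -> j != l ->
  exists2 p : {perm 'I_n}, moved p = [set i; j; k; l] & p i = j /\ p k = l.
Proof.
move=> nij nkl nik njl.
have [li|nli] := eqVneq l i.
  subst l; have [jk|njk] := eqVneq j k.
    subst k; exists (tperm i j); last by rewrite tpermL tpermR.
    apply/setP => x; rewrite !inE; case: tpermP => [->|->|/eqP xi /eqP xj].
    - by rewrite eqxx eq_sym nij.
    - by rewrite eqxx nij orbT.
    - by rewrite eqxx (negbTE xi) (negbTE xj).
  have pi : (tperm i j * tperm k i)%g i = j by rewrite permM tpermL tpermD // eq_sym.
  have pk : (tperm i j * tperm k i)%g k = i.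
    by rewrite permM [tperm i j k]tpermD ?tpermL.
  have pj : (tperm i j * tperm k i)%g j = k by rewrite permM tpermR tpermR.
  exists (tperm i j * tperm k i)%g => //; apply/setP => x; rewrite !inE.
  have [->|nxi] := eqVneq x i; first by rewrite pi eq_sym.
  have [->|nxj] := eqVneq x j; first by rewrite pj eq_sym.
  have [->|nxk] := eqVneq x k; first by rewrite pk.
  by rewrite permM [tperm i j x]tpermD 1?eq_sym // tpermD 1?eq_sym // eqxx.
have pi : (tperm k l * tperm i j)%g i = j.
  by rewrite permM [tperm k l i]tpermD ?tpermL // eq_sym.
have pk : (tperm k l * tperm i j)%g k = l.
  by rewrite permM tpermL tpermD // eq_sym.
exists (tperm k l * tperm i j)%g => //; apply/setP => x; rewrite !inE.
have [->|nxi] := eqVneq x i; first by rewrite pi eq_sym.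
have [->|nxk] := eqVneq x k; first by rewrite pk eq_sym nkl orbT.
have [->|nxl] := eqVneq x l.
  rewrite permM tpermR orbT; have [->|njk] := eqVneq j k.
    by rewrite tpermR eq_sym.
  by rewrite tpermD.
rewrite permM [tperm k l x]tpermD 1?eq_sym // !orbF /=.
have [->|nxj] := eqVneq x j; first by rewrite tpermR eq_sym nij.
by rewrite tpermD 1?eq_sym // eqxx.
Qed.

(** Combine the permutation [p] of q <= 4 points with any derangement of the others; there are
    d_{n-q} >= (n-q-2)! >= (n-6)! of these. *)
Lemma card_derangements_through2 n (i j k l : 'I_n) :
  5 < n -> i != j -> k != l -> i != k -> j != l ->
  (n - 6)`! <= #|[set s : {perm 'I_n} | [&& s i == j, s k == l & moved s == [set: 'I_n]]]|.
Proof.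
move=> n5 nij nkl nik njl.
have [p mp [pi pk]] := exists_cyclic_extension nij nkl nik njl.
set Q := [set i; j; k; l] in mp.
have cQ : #|Q| <= 4.
  have -> : Q = i |: (j |: [set k; l]) by apply/setP => x; rewrite !inE -!orbA.
  by rewrite !cardsU1 cards1; do 3 case: (_ \notin _).
have jQ : j \in Q by rewrite !inE eqxx orbT.
have lQ : l \in Q by rewrite !inE eqxx !orbT.
clearbody Q; have pQ x : (p x \in Q) = (x \in Q).
  by rewrite -mp !inE (inj_eq perm_inj).
have := card_moved_compl Q; set D := [set s | _] => cD.
apply: (@leq_trans #|D|).
  rewrite cD; move: #|Q| cQ => q q4.
  have -> : n - q = (n - q - 2).+2 by lia.
  by apply: leq_trans (derangements_ge _); apply: leq_fact; lia.
rewrite -(card_imset _ (mulgI p)); apply/subset_leq_card/subsetP => s /imsetP[d].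
rewrite !inE => /eqP md ->.
have dQ x : x \in Q -> d x = x.
  by move=> xQ; apply/eqP; move/setP/(_ x): md; rewrite !inE xQ => /negbFE.
rewrite !permM pi pk !dQ // !eqxx /=; apply/eqP/setP => x; rewrite !inE permM.
have [xQ|xQ] := boolP (x \in Q); first by rewrite dQ ?pQ // ; move: xQ; rewrite -mp inE.
have -> : p x = x by apply/eqP; move: xQ; rewrite -mp inE negbK.
by move/setP/(_ x): md; rewrite !inE xQ.
Qed.

(** After translation by [t1^-1] the permutations sought are derangements with value [j'] at [i].
    Prescribing also the value [p k] at a suitable [k] makes them meet [t2] there. *)
Lemma card_coset_disjoint_meet n (i j : 'I_n) (t1 t2 : {perm 'I_n}) :
  5 < n -> t1 != t2 -> t1 i != j -> t2 i != j ->
  (n - 6)`! <=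
    #|[set s : {perm 'I_n} | [&& s i == j, ~~ perm_intersect s t1 & perm_intersect s t2]]|.
Proof.
move=> n5 nt t1ij t2ij; set p := (t2 * t1^-1)%g; set j' := t1^-1%g j.
have nij : i != j' by apply: contraNneq t1ij => ->; rewrite permKV.
have pij : p i != j' by rewrite permM (inj_eq perm_inj).
(* If [p] moves [i], take the point that [p] sends to [i]. Otherwise some [x] is moved, since [t1]
   and [t2] differ; either [x] works, or [p x = j'] and then [p x] works. *)
have [k [nik pkk pkj]] : exists k, [/\ i != k, p k != k & p k != j'].
  have [pii|pii] := eqVneq (p i) i; last first.
    exists (p^-1%g i); rewrite permKV nij.
    by split; rewrite // -(inj_eq (@perm_inj _ p)) permKV.
  have [x px] : exists x, p x != x.
    apply/existsP; apply: contraR nt; rewrite negb_exists => /forallP h.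
    apply/eqP/permP => x; have /eqP := negbNE (h x); rewrite permM => e.
    by rewrite -{1}e permKV.
  have nix : i != x by apply: contraNneq px => <-; rewrite pii.
  have ppx : p (p x) != p x by rewrite (inj_eq perm_inj).
  have [pxj|pxj] := eqVneq (p x) j'; last by exists x.
  exists (p x); split=> //; last by rewrite -[j' in X in _ != X]pxj.
  by rewrite -{1}pii (inj_eq perm_inj).
have njl : j' != p k by rewrite eq_sym.
have nkl : k != p k by rewrite eq_sym.
apply: leq_trans (card_derangements_through2 n5 nij nkl nik njl) _.
rewrite -(card_imset _ (mulIg t1)); apply/subset_leq_card/subsetP => _ /imsetP[s + ->].
rewrite !inE => /and3P[/eqP si /eqP sk ms]; apply/and3P; split.
- by rewrite permM si permKV.
- by rewrite perm_intersect_mulV mulgK perm_intersect1 ms.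
- by apply/perm_intersectP; exists k; rewrite permM sk permM permKV.
Qed.

(** * Spread families and random colourings *)

Section Colouring.
Variable E : finType.
Implicit Types (c : {ffun E -> 'I_4}) (a b : 'I_4) (H : {set {set E}}) (T S W : {set E}).

Definition colour_class c a : {set E} := [set e | c e == a].

Definition recolour a T c : {ffun E -> 'I_4} := [ffun e => if e \in T then a else c e].

(** [W] is the part of the ground set exposed so far: a trace is what remains to be covered of a
    member, and an empty trace means that [W] contains one. *)
Definition traces H W : {set {set E}} := [set S :\: W | S in H].

Definition min_traces H W : {set {set E}} := [set T | minset (mem (traces H W)) T].

Lemma min_traces_sub H W S :
  S \in H -> exists2 T, T \in min_traces H W & T \subset S :\: W.
Proof.
move=> SH; have [|T mT TS] := @minset_exists _ (mem (traces H W)) (S :\: W).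
  exact: imset_f.
by exists T; rewrite ?inE.
Qed.

Lemma min_traces_trace H W T :
  T \in min_traces H W -> exists2 S, S \in H & T = S :\: W.
Proof. by rewrite inE => /minsetP[/imsetP[S SH ->] _]; exists S. Qed.

Lemma min_traces_min H W T S :
  T \in min_traces H W -> S \in H -> S :\: W \subset T -> S :\: W = T.
Proof. by rewrite inE => /minsetP[_ h] SH /h; apply; apply: imset_f. Qed.

Lemma colour_class_recolour a T c :
  colour_class (recolour a T c) a = T :|: colour_class c a.
Proof. by apply/setP => e; rewrite !inE ffunE; case: ifP; rewrite ?eqxx. Qed.

(** Recolouring forgets only the colours on [T], so its fibres have at most [4 ^ #|T|] elements. *)
Lemma card_recolour_preimage a T (D D' : {set {ffun E -> 'I_4}}) :
  (forall c, c \in D -> recolour a T c \in D') -> #|D| <= 4 ^ #|T| * #|D'|.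
Proof.
move=> DD'.
pose f c : {ffun E -> 'I_4} * {ffun E -> 'I_4} :=
  ([ffun e => if e \in T then c e else ord0], recolour a T c).
have injf : injective f.
  move=> c c' [/ffunP h1 /ffunP h2]; apply/ffunP => e.
  by have := h1 e; have := h2 e; rewrite !ffunE; case: ifP.
have <- : #|pffun_on (ord0 : 'I_4) (mem T) (@predT 'I_4)| = 4 ^ #|T|.
  by rewrite card_pffun_on card_ord.
rewrite -(card_imset _ injf) -cardX; apply/subset_leq_card/subsetP => _ /imsetP[c cD ->].
rewrite inE /= DD' // andbT; apply/pffun_onP; split; last by [].
by apply/subsetP => e; rewrite !inE ffunE; case: ifP; rewrite ?eqxx.
Qed.

(* Recolouring a minimal trace T with the colour a produces a colouring whose
   a-class contains a member of H; every such member contains T, so T is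
   recovered by choosing #|T| elements of one canonical member. *)
Lemma count_min_traces (H : {ffun E -> 'I_4} -> {set {set E}}) a k t :
  (forall c S, S \in H c -> #|S| <= k) ->
  (forall c T, T \in min_traces (H c) (colour_class c a) -> H (recolour a T c) = H c) ->
  \sum_c #|[set T in min_traces (H c) (colour_class c a) | #|T| == t]|
    <= 4 ^ t * ('C(k, t) * 4 ^ #|E|).
Proof.
move=> Hk Hrec.
(* The canonical member; the default [set0] keeps the size bound valid when the colour class
   contains no member. *)
pose member c := odflt set0 [pick S in H c | S \subset colour_class c a].
have member_card c : #|member c| <= k.
  by rewrite /member; case: pickP => [S /andP[/Hk]|] //=; rewrite cards0.
have member_sup c T : T \in min_traces (H c) (colour_class c a) ->
    T \subset member (recolour a T c).
  move=> mT; rewrite /member Hrec //; case: pickP => [S /andP[SH]|].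
    rewrite colour_class_recolour => SS /=.
    rewrite -(min_traces_min mT SH) ?subsetDl //.
    by rewrite subDset setUC.
  have [S SH eT] := min_traces_trace mT.
  by move=> /(_ S) /=; rewrite SH colour_class_recolour eT setUC -subDset subxx.
pose D T := [set c | T \in min_traces (H c) (colour_class c a)].
pose D' T := [set c | T \subset member c].
have DD' T : #|D T| <= 4 ^ #|T| * #|D' T|.
  by apply: (@card_recolour_preimage a) => c; rewrite !inE => mT; apply: member_sup; rewrite inE.
have swap (P : {ffun E -> 'I_4} -> pred {set E}) :
    \sum_c #|[set T | P c T && (#|T| == t)]| =
    \sum_(T : {set E} | #|T| == t) #|[set c | P c T]|.
  transitivity (\sum_c \sum_(T : {set E} | #|T| == t) (P c T : nat)).
    apply: eq_bigr => c _; rewrite -sum1dep_card big_mkcond [RHS]big_mkcond /=.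
    by apply: eq_bigr => T _; case: (P c T); case: (_ == _).
  rewrite exchange_big; apply: eq_bigr => T _; rewrite -sum1dep_card [RHS]big_mkcond /=.
  by apply: eq_bigr => c _; case: (P c T).
rewrite (swap (fun c T => T \in min_traces (H c) (colour_class c a))).
apply: (@leq_trans (\sum_(T : {set E} | #|T| == t) 4 ^ t * #|D' T|)).
  by apply: leq_sum => T /eqP <-; apply: DD'.
rewrite -big_distrr /= leq_mul2l; apply/orP; right.
rewrite -(swap (fun c T => T \subset member c)).
apply: (@leq_trans (\sum_(c : {ffun E -> 'I_4}) 'C(k, t))).
  by apply: leq_sum => c _; rewrite cards_draws leq_bin2l.
by rewrite sum_nat_const card_ffun card_ord mulnC.
Qed.

Local Open Scope ring_scope.

(** In a spread family the share of members containing [T] is of order at most r^-|T|, hence this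
    weight. Averaged over colourings, the traces of size t contribute at most C(k,t) (4/r)^t. *)
Lemma weight_min_traces (H : {ffun E -> 'I_4} -> {set {set E}}) a (k lo r : nat) :
  (forall c S, S \in H c -> (#|S| <= k)%N) ->
  (forall c T, T \in min_traces (H c) (colour_class c a) -> H (recolour a T c) = H c) ->
  \sum_c \sum_(T in min_traces (H c) (colour_class c a) | (lo <= #|T|)%N) (r%:R ^- #|T| : rat)
    <= (4 ^ #|E|)%N%:R * \sum_(t < k.+1 | (lo <= t)%N) 'C(k, t)%:R * (4 / r%:R) ^+ t.
Proof.
move=> Hk Hrec.
have traces_le c T : T \in min_traces (H c) (colour_class c a) -> (#|T| < k.+1)%N.
  move=> /min_traces_trace[S /Hk Sk ->]; rewrite ltnS.
  by apply: leq_trans Sk; rewrite subset_leq_card // subsetDl.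
have -> : \sum_c \sum_(T in min_traces (H c) (colour_class c a) | (lo <= #|T|)%N)
    (r%:R ^- #|T| : rat) =
    \sum_(t < k.+1 | (lo <= t)%N)
      (\sum_c #|[set T in min_traces (H c) (colour_class c a) | #|T| == t]|)%N%:R * r%:R ^- t.
  under [RHS]eq_bigr do rewrite natr_sum mulr_suml.
  rewrite exchange_big; apply: eq_bigr => c _.
  rewrite (partition_big (fun T => inord #|T| : 'I_k.+1) (fun t : 'I_k.+1 => (lo <= t)%N)) /=; last first.
    by move=> T /andP[mT loT]; rewrite inordK ?(traces_le c).
  apply: eq_bigr => t lot.
  have -> : #|[set T in min_traces (H c) (colour_class c a) | #|T| == t]|%:R * r%:R ^- t =
     \sum_(T in [set T in min_traces (H c) (colour_class c a) | #|T| == t]) (r%:R ^- t : rat).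
    by rewrite sumr_const -[RHS]mulr_natl.
  apply: eq_big => [T|T /andP[/andP[mT _] /eqP <-]]; last by rewrite inordK ?(traces_le c).
  rewrite [in RHS]inE.
  have [mT|] //= := boolP (T \in min_traces _ _).
  rewrite -val_eqE /= inordK ?(traces_le c) // andb_idl // => /eqP ->; exact: lot.
rewrite mulr_sumr; apply: ler_sum => t _.
have := count_min_traces t Hk Hrec; rewrite -(ler_nat rat) => h.
apply: le_trans (ler_wpM2r _ h) _; first by rewrite invr_ge0 exprn_ge0 // ler0n.
by rewrite !natrM expr_div_n natrX le_eqVlt; apply/orP; left; apply/eqP; ring.
Qed.

(* Two rounds of exposure, first the colour a and then the colour b: the first
   one leaves traces of size less than w, the second one leaves nothing. *)
Lemma spread_family_fails (I : finType) (F : {set I}) (S : I -> {set E}) (k w r : nat) a b :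
  a != b -> (0 < r)%N -> (0 < #|F|)%N ->
  (forall i, i \in F -> (#|S i| <= k)%N) ->
  (forall T, (#|[set i in F | T \subset S i]| * r ^ #|T| <= 2 * #|F|)%N) ->
  \sum_(t < k.+1 | (w <= t)%N) 'C(k, t)%:R * (4 / r%:R) ^+ t +
  \sum_(t < w.+1 | (1 <= t)%N) 'C(w, t)%:R * (4 / r%:R) ^+ t < 4^-1 :> rat ->
  (2 * #|[set c | [forall i in F, ~~ (S i \subset colour_class c a :|: colour_class c b)]]|
     < 4 ^ #|E|)%N.
Proof.
move=> nab r0 F0 Sk Sspread small.
pose H1 := [set S i | i in F].
pose H2 c := [set T in min_traces H1 (colour_class c a) | (#|T| < w)%N].
set fail := [set c | _].
have H1k (c : {ffun E -> 'I_4}) T : T \in H1 -> (#|T| <= k)%N by case/imsetP=> i /Sk ? ->.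
have H2w c T : T \in H2 c -> (#|T| <= w)%N by rewrite inE => /andP[_ /ltnW].
(* Such a [T] lies in a trace avoiding the class of [a], so giving it the colour [b] changes neither
   that class nor [H2 c]. *)
have rec2 c T : T \in min_traces (H2 c) (colour_class c b) -> H2 (recolour b T c) = H2 c.
  move=> /min_traces_trace[U + eT]; rewrite inE => /andP[/min_traces_trace[V _ eU] _].
  rewrite /H2 (_ : colour_class (recolour b T c) a = colour_class c a) //.
  apply/setP => e; rewrite !inE ffunE eT eU !inE.
  case: (c e =P a) => [->|/eqP nea]; first by rewrite /= andbF eqxx.
  by case: ifP => _; rewrite ?(negbTE nea) // eq_sym (negbTE nab).
have w1 := @weight_min_traces (fun=> H1) a k w r H1k (fun _ _ _ => erefl).
have w2 := @weight_min_traces H2 b w 1 r H2w rec2.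
(* When [c] fails, each member of [F] contains a first-round trace of size at least [w] or a
   nonempty second-round trace. Each [T] lies in at most 2|F| r^-|T| members, so the weights sum to
   at least 1/2. *)
have cover c : c \in fail ->
  2^-1 <= \sum_(T in min_traces H1 (colour_class c a) | (w <= #|T|)%N) (r%:R ^- #|T| : rat) +
     \sum_(T in min_traces (H2 c) (colour_class c b) | (1 <= #|T|)%N) (r%:R ^- #|T| : rat).
  rewrite inE => /forall_inP cfail.
  pose FT (T : {set E}) := [set i in F | T \subset S i].
  have FTle T : #|FT T|%:R <= 2 * #|F|%:R * (r%:R ^- #|T|) :> rat.
    rewrite ler_pdivlMr ?exprn_gt0 ?ltr0n //.
    by rewrite -natrX -!natrM ler_nat; apply: Sspread.
  have Fcov : F \subset
      (\bigcup_(T in min_traces H1 (colour_class c a) | (w <= #|T|)%N) FT T) :|: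
      (\bigcup_(T in min_traces (H2 c) (colour_class c b) | (1 <= #|T|)%N) FT T).
    apply/subsetP => i iF; rewrite inE.
    have [T mT TS] := min_traces_sub (colour_class c a) (imset_f S iF).
    have TSi := subset_trans TS (subsetDl _ _).
    have [wT|Tw] := leqP w #|T|.
      by apply/orP; left; apply/bigcupP; exists T; rewrite ?mT // inE iF.
    have TH2 : T \in H2 c by rewrite inE mT.
    have [U mU UT] := min_traces_sub (colour_class c b) TH2.
    have UTi := subset_trans (subset_trans UT (subsetDl _ _)) TSi.
    apply/orP; right; apply/bigcupP; exists U; last by rewrite inE iF.
    rewrite mU card_gt0 /=; apply/negP => /eqP U0.
    have [V + eV] := min_traces_trace mU; rewrite inE => /andP[/min_traces_trace[V' VH1 eV'] _].
    have /imsetP[j jF eV''] := VH1.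
    have /negP := cfail j jF; apply; rewrite -eV'' -subDset -eV'.
    by rewrite -setD_eq0 -eV U0.
  have bigU (P : pred {set E}) :
      #|\bigcup_(T | P T) FT T|%:R <= 2 * #|F|%:R * \sum_(T | P T) (r%:R ^- #|T|) :> rat.
    rewrite mulr_sumr; elim/big_rec2: _ => [|T x y PT IH]; first by rewrite cards0.
    apply: le_trans (lerD (FTle T) IH); rewrite -natrD ler_nat cardsU.
    exact: leq_subr.
  have := leq_trans (subset_leq_card Fcov) (leq_card_setU _ _).
  rewrite -(ler_nat rat) natrD => /le_trans /(_ (lerD (bigU _) (bigU _))).
  rewrite -mulrDr -[X in X <= _]mulr1 -mulrA mulrCA ler_pM2l ?ltr0n // => h.
  by rewrite -(ler_pM2l (x := 2)) // mulfV.
(* The total weight is below a quarter of the number of colourings, and each failing colouring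
   carries at least 1/2. *)
have : \sum_(c in fail) (2^-1 : rat) < (4 ^ #|E|)%N%:R * 4^-1.
  apply: le_lt_trans (ler_sum _ cover) _.
  apply: (@le_lt_trans _ _ (\sum_c (\sum_(T in min_traces H1 (colour_class c a) | (w <= #|T|)%N)
      (r%:R ^- #|T| : rat) +
     \sum_(T in min_traces (H2 c) (colour_class c b) | (1 <= #|T|)%N) (r%:R ^- #|T| : rat)))).
    rewrite big_mkcond; apply: ler_sum => c _; case: ifP => // _.
    by apply: addr_ge0; apply: sumr_ge0 => T _; rewrite invr_ge0 exprn_ge0 // ler0n.
  rewrite big_split /=; apply: le_lt_trans (lerD w1 w2) _.
  by rewrite -mulrDr ltr_pM2l // ltr0n expn_gt0.
rewrite sumr_const -[_ *+ _]mulr_natl -(ltr_nat rat) natrM; lra.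
Qed.
End Colouring.

(** * Numerical estimates *)

Lemma expSn_le_double m k : 2 * k <= m.+1 -> m.+1 ^ k <= 2 * m ^ k.
Proof.
(* Bernoulli's inequality for (1 - 1/(m+1))^l, with denominators cleared. *)
have bernoulli l : m.+1 ^ l * m.+1 <= m ^ l * m.+1 + l * m.+1 ^ l.
  elim: l => [|l IH]; first by rewrite !expn0 mul0n addn0.
  have le_pow : m ^ l <= m.+1 ^ l by case: l {IH} => // l; rewrite leq_exp2r.
  by rewrite !expnS; nia.
by move=> km; have := bernoulli k; nia.
Qed.

Lemma expSn_le m x : x <= m -> m.+1 ^ x <= 4 * m ^ x.
Proof.
move=> xm; rewrite -[x]odd_double_half -addnn addnA !(expnD _ (_ + _)).
have h1 : 2 * x./2 <= m.+1 by lia.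
have h2 : 2 * (odd x + x./2) <= m.+1 by lia.
apply: leq_trans (leq_mul (expSn_le_double h2) (expSn_le_double h1)) _.
by rewrite mulnACA.
Qed.

(** This replaces Stirling's formula: for x = n it reads n^n <= 4^n n!. Each induction step costs
    one factor 4, by [expSn_le]. *)
Lemma exp_le_ffact n x : x <= n -> n ^ x <= 4 ^ x * n ^_ x.
Proof.
elim: n x => [|n IH] [|x] //; rewrite ltnS => xn.
rewrite ffactSS [n.+1 ^ _]expnS [4 ^ _]expnS.
have := leq_mul (leqnn n.+1) (leq_trans (expSn_le xn) (leq_mul (leqnn 4) (IH x xn))).
by move=> h; apply: leq_trans h (eq_leq _); ring.
Qed.

Lemma ffact_le_exp n t : n ^_ t <= n ^ t.
Proof.
elim: t n => [|t IH] n //; rewrite ffactnS expnS leq_mul2l; apply/orP; right.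
case: n => [|n]; first by apply: leq_trans (IH _) _; case: t {IH}.
by apply: leq_trans (IH _) _; case: t {IH} => // t; rewrite leq_exp2r.
Qed.

(** Since t^t <= 4^t t!, the left side is at most (64 n / t)^t, and 64 n <= r w <= r t. *)
Lemma bin_exp_le n t w r :
  0 < t -> w <= t -> 64 * n <= r * w -> 'C(n, t) * 16 ^ t <= r ^ t.
Proof.
move=> t0 wt nr; rewrite -(leq_pmul2r (m := t ^ t)) ?expn_gt0 ?t0 //.
rewrite -mulnA; apply: (@leq_trans ('C(n, t) * (16 ^ t * (4 ^ t * t`!)))).
  by rewrite !leq_mul2l -ffactnn exp_le_ffact ?orbT.
rewrite (_ : 'C(n, t) * _ = 64 ^ t * n ^_ t); last first.
  by rewrite -bin_ffact (_ : 64 = 16 * 4) // expnMn; ring.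
apply: (@leq_trans ((64 * n) ^ t)); first by rewrite expnMn leq_mul2l ffact_le_exp orbT.
rewrite -expnMn leq_exp2r //; apply: leq_trans nr _; by rewrite leq_mul2l wt orbT.
Qed.

Section Numeric.
Local Open Scope ring_scope.

Lemma sum_geometric_le N lo :
  \sum_(t < N | (lo <= t)%N) (4 ^- t : rat) <= 4 / 3 * 4 ^- lo.
Proof.
(* Subtracting the missing tail makes the induction on [N] go through. *)
suff h : \sum_(t < N | (lo <= t)%N) (4 ^- t : rat) <= 4 / 3 * (4 ^- lo - 4 ^- (maxn lo N)).
  apply: le_trans h _; rewrite ler_pM2l // lerBlDr lerDl invr_ge0 exprn_ge0 //.
elim: N => [|N IH]; first by rewrite big_ord0 maxn0 subrr mulr0.
rewrite big_mkcond big_ord_recr -big_mkcond /=.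
case: leqP => loN; last first.
  by rewrite addr0; apply: le_trans IH _; rewrite (maxn_idPl (ltnW loN)) (maxn_idPl loN).
rewrite (maxn_idPr loN) in IH; rewrite (maxn_idPr (leqW loN)).
rewrite exprS invfM; move: IH; set x := 4 ^- N; lra.
Qed.

(** The terms of the first sum are at most 4^-t with t >= 3, those of the second at most 4^-(t+1),
    for a total of at most 1/48 + 1/12. Two rounds let r be of order sqrt k, with w of the same
    order. *)
Lemma exposure_sums_small (k w r : nat) :
  (2 < w)%N -> (64 * k <= r * w)%N -> (64 * w <= r)%N ->
  \sum_(t < k.+1 | (w <= t)%N) 'C(k, t)%:R * (4 / r%:R) ^+ t +
  \sum_(t < w.+1 | (1 <= t)%N) 'C(w, t)%:R * (4 / r%:R) ^+ t < 4^-1 :> rat.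
Proof.
move=> w2 kr wr; have r0 : (0 < r)%N by lia.
have term (b t e : nat) : (b * 4 ^ t * 4 ^ e <= r ^ t)%N ->
    b%:R * (4 / r%:R) ^+ t <= 4 ^- e :> rat.
  rewrite -(ler_nat rat) !natrM !natrX => h.
  rewrite -[X in _ <= X]mul1r ler_pdivlMr ?exprn_gt0 // expr_div_n.
  by rewrite mulrA mulrAC ler_pdivrMr ?exprn_gt0 ?ltr0n // mul1r.
apply: (@le_lt_trans _ _ (4 / 3 * 4 ^- 3 + 4 / 3 * 4 ^- 2)); last by lra.
apply: lerD.
  apply: (@le_trans _ _ (\sum_(t < k.+1 | (w <= t)%N) 4 ^- t)).
    apply: ler_sum => t wt; apply: term; rewrite -mulnA -expnMn.
    by apply: (@bin_exp_le k t w r) => //; lia.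
  apply: le_trans (sum_geometric_le _ _) _; rewrite ler_pM2l // lef_pV2 ?posrE ?exprn_gt0 //.
  by apply: ler_weXn2l => //; lra.
apply: (@le_trans _ _ (\sum_(t < w.+1 | (1 <= t)%N) 4 ^- t.+1)).
  apply: ler_sum => t t1; apply: term.
  apply: (@leq_trans (w ^ t * 4 ^ t * 16 ^ t)); last first.
    by rewrite -!expnMn leq_exp2r //; lia.
  apply: leq_mul.
    rewrite leq_mul2r; apply/orP; right; apply: leq_trans (ffact_le_exp _ _).
    by rewrite -bin_ffact leq_pmulr // fact_gt0.
  by rewrite (_ : 16 = 4 ^ 2)%N // -expnM leq_exp2l //; lia.
have -> : \sum_(t < w.+1 | (1 <= t)%N) 4 ^- t.+1 =
    4^-1 * \sum_(t < w.+1 | (1 <= t)%N) (4 ^- t : rat).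
  by rewrite mulr_sumr; apply: eq_bigr => t _; rewrite exprS invfM.
by have := sum_geometric_le w.+1 1; lra.
Qed.

End Numeric.

Lemma disjoint_members_of_spread (E I J : finType) (F : {set I}) (G : {set J})
    (S : I -> {set E}) (R : J -> {set E}) (k w r : nat) :
  2 < w -> 64 * k <= r * w -> 64 * w <= r ->
  0 < #|F| -> (forall i, i \in F -> #|S i| <= k) ->
  (forall T : {set E}, #|[set i in F | T \subset S i]| * r ^ #|T| <= 2 * #|F|) ->
  0 < #|G| -> (forall j, j \in G -> #|R j| <= k) ->
  (forall T : {set E}, #|[set j in G | T \subset R j]| * r ^ #|T| <= 2 * #|G|) ->
  exists i j, [/\ i \in F, j \in G & [disjoint S i & R j]].
Proof.
move=> w2 kr wr F0 Sk Ss G0 Rk Rs.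
have r0 : 0 < r by lia.
have sm := exposure_sums_small w2 kr wr.
pose c0 : 'I_4 := inord 0; pose c1 : 'I_4 := inord 1.
pose c2 : 'I_4 := inord 2; pose c3 : 'I_4 := inord 3.
have n01 : c0 != c1 by rewrite -val_eqE /= !inordK.
have n23 : c2 != c3 by rewrite -val_eqE /= !inordK.
have := spread_family_fails n01 r0 F0 Sk Ss sm.
have := spread_family_fails n23 r0 G0 Rk Rs sm.
set f2 := [set c | _]; set f1 := [set c | _] => h2 h1.
have : ~~ ([set: {ffun E -> 'I_4}] \subset f1 :|: f2).
  apply/negP => /subset_leq_card; rewrite cardsT card_ffun card_ord => h.
  have := leq_trans h (leq_card_setU f1 f2); move: h1 h2.
  by move: (4 ^ #|E|) #|f1| #|f2|; lia.
move=> /subsetPn[c _]; rewrite !inE negb_or !negb_forall => /andP[/existsP[i +] /existsP[j +]].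
rewrite !negb_imply => /and3P[iF iS _] /and3P[jG jR _].
exists i, j; split => //; rewrite -setI_eq0 -subset0; apply/subsetP => e; rewrite inE.
move=> /andP[/(subsetP iS) + /(subsetP jR)]; rewrite !inE => /orP[]/eqP-> /orP[].
all: by rewrite -val_eqE /= !inordK.
Qed.

(** * Cores of families of permutations *)

Section Cores.
Variable n : nat.
Implicit Types (A B F : {set {perm 'I_n}}) (X Y T : {set 'I_n * 'I_n}) (r q : nat).

Definition link F Y : {set {perm 'I_n}} := [set s in F | Y \subset graph s].

Definition spread_over r X F : bool :=
  [&& 0 < #|F|, [forall s in F, X \subset graph s] &
      [forall Y : {set 'I_n * 'I_n}, (X \subset Y) ==> (#|link F Y| * r ^ #|Y| <= #|F| * r ^ #|X|)]].

(** [F] ranges over all subfamilies of [A], so that a core found for the uncovered part of [A] is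
    also a core of [A]. *)
Definition cores r q A : {set {set 'I_n * 'I_n}} :=
  [set X : {set 'I_n * 'I_n} | (#|X| <= q) && [exists F : {set {perm 'I_n}}, (F \subset A) && spread_over r X F]].

Definition uncovered r q A : {set {perm 'I_n}} :=
  [set s in A | [forall X in cores r q A, ~~ (X \subset graph s)]].

Lemma spread_link_exists r A : 0 < #|A| ->
  exists2 X, spread_over r X (link A X) & #|A| <= #|link A X| * r ^ #|X|.
Proof.
move=> A0.
have [X _ Xmax] := @arg_maxnP _ set0 predT (fun X => #|link A X| * r ^ #|X|) isT.
have AX : #|A| <= #|link A X| * r ^ #|X|.
  apply: leq_trans (Xmax set0 isT); rewrite cards0 expn0 muln1 subset_leq_card //.
  by apply/subsetP => s; rewrite inE sub0set andbT.
exists X => //; apply/and3P; split.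
- by rewrite lt0n; apply: contraTneq AX => ->; rewrite mul0n -ltnNge.
- by apply/forall_inP => s; rewrite inE => /andP[].
apply/forallP => Y; apply/implyP => XY.
suff -> : link (link A X) Y = link A Y by exact: Xmax.
apply/setP => s; rewrite !inE -andbA; case: (s \in A) => //=.
by rewrite andb_idl // => /(subset_trans XY).
Qed.

(** Otherwise a spread link of the uncovered part has a core X with |A0| <= r^|X| (n-|X|)!, which
    forces |X| <= q by [sizes]; X is then a core of [A] inside an uncovered permutation. *)
Lemma card_uncovered r q A :
  (forall x, q < x <= n -> r ^ x * (n - x)`! * n ^ 6 <= n`!) ->
  #|uncovered r q A| * n ^ 6 <= n`!.
Proof.
move=> sizes; rewrite leqNgt; apply/negP => big; set A0 := uncovered r q A in big.
have A0gt : 0 < #|A0| by rewrite lt0n; apply: contraTneq big => ->; rewrite mul0n.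
have [X sX AX] := spread_link_exists r A0gt.
have /and3P[/card_gt0P[s]] := sX; rewrite inE => /andP[sA0 Xs] _ _.
have Xn : #|X| <= n by rewrite -[leqRHS](card_graph s) subset_leq_card.
have Xq : #|X| <= q.
  rewrite leqNgt; apply/negP => qX; have := sizes #|X|; rewrite qX Xn => /(_ isT).
  rewrite leqNgt => /negP; apply; apply: leq_trans big _; rewrite leq_mul2r; apply/orP; right.
  apply: leq_trans AX _; rewrite mulnC leq_mul2l; apply/orP; right.
  apply: leq_trans (card_graph_superset X); apply/subset_leq_card/subsetP => u.
  by rewrite !inE => /andP[].
move: (sA0); rewrite inE => /andP[_ /forall_inP /(_ X)]; rewrite Xs => h.
suff /h : X \in cores r q A by [].
rewrite inE Xq; apply/existsP; exists (link A0 X); rewrite sX andbT.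
by apply/subsetP => u; rewrite !inE => /andP[/andP[]].
Qed.

(** Each point of [Y] lies in at most a fraction 1/r of [F], so at least half of [F] avoids [Y]; the
    factor 2 in the conclusion is this loss. *)
Lemma spread_over_avoid r q X Y F :
  0 < q -> 2 * q <= r -> #|Y| <= q -> [disjoint X & Y] -> spread_over r X F ->
  let F' := [set s in F | [disjoint Y & graph s]] in
  0 < #|F'| /\
  forall T, #|[set s in F' | T \subset graph s :\: X]| * r ^ #|T| <= 2 * #|F'|.
Proof.
move=> q0 qr Yq XY /and3P[F0 /forall_inP FX /forallP Fs] F'.
have r0 : 0 < r by lia.
have {}Fs Y' : [disjoint X & Y'] -> #|link F (X :|: Y')| * r ^ #|Y'| <= #|F|.
  move=> dXY; have := implyP (Fs (X :|: Y')) (subsetUl _ _).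
  by rewrite cardsU disjoint_setI0 // cards0 subn0 expnD mulnCA mulnC leq_pmul2r // expn_gt0 r0.
have bad : #|F :\: F'| * r <= q * #|F|.
  apply: (@leq_trans ((\sum_(y in Y) #|link F (X :|: [set y])|) * r)).
    rewrite leq_mul2r; apply/orP; right.
    apply: (@leq_trans #|\bigcup_(y in Y) link F (X :|: [set y])|).
      apply/subset_leq_card/subsetP => s; rewrite !inE => /andP[+ sF].
      rewrite sF /= -setI_eq0 => /set0Pn[y /setIP[yY ys]].
      by apply/bigcupP; exists y => //; rewrite inE sF subUset FX // sub1set.
    elim/big_rec2: _ => [|y u U yY IH]; first by rewrite cards0.
    by apply: leq_trans (leq_card_setU _ _) _; rewrite leq_add2l.
  rewrite big_distrl /=; apply: (@leq_trans (\sum_(y in Y) #|F|)).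
    apply: leq_sum => y yY; have := Fs [set y]; rewrite cards1 expn1; apply.
    by rewrite disjoint_sym disjoints1 (disjointFl XY yY).
  by rewrite sum_nat_const leq_mul2r Yq orbT.
have half : #|F| <= 2 * #|F'|.
  have e : #|F| = #|F'| + #|F :\: F'|.
    by rewrite -(cardsID F' F) (setIidPr _) //; apply/subsetP => s; rewrite inE => /andP[].
  move: bad; rewrite e; move: #|F'| #|F :\: F'| => f g; nia.
split; first by move: F0 half; case: #|F'| => //; rewrite muln0; case: #|F|.
move=> T; apply: leq_trans half.
(* Any member counted on the left shows that [T] is disjoint from [X]. *)
have [->|/set0Pn[s]] := eqVneq [set s in F' | T \subset graph s :\: X] set0.
  by rewrite cards0.
rewrite inE subsetD => /and3P[_ _ dTX].
apply: leq_trans (Fs T _); last by rewrite disjoint_sym.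
rewrite leq_mul2r; apply/orP; right; apply/subset_leq_card/subsetP => u.
rewrite !inE subsetD => /andP[/andP[uF _] /andP[Tu _]].
by rewrite uF subUset FX.
Qed.

Lemma cores_cross r q w A B X Y :
  2 < w -> 64 * n <= r * w -> 64 * w <= r -> 0 < q -> 2 * q <= r ->
  cross_intersecting A B -> X \in cores r q A -> Y \in cores r q B ->
  ~~ [disjoint X & Y].
Proof.
move=> w2 nr wr q0 qr cAB; rewrite !inE.
move=> /andP[Xq /existsP[F /andP[FA sF]]] /andP[Yq /existsP[G /andP[GB sG]]].
apply/negP => XY.
have [F0 Fs] := spread_over_avoid q0 qr Yq XY sF.
rewrite disjoint_sym in XY.
have [G0 Gs] := spread_over_avoid q0 qr Xq XY sG.
have cardD Z (s : {perm 'I_n}) : #|graph s :\: Z| <= n.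
  by rewrite -[leqRHS](card_graph s) subset_leq_card // subsetDl.
have [s [t [sF' tG' dst]]] :=
  disjoint_members_of_spread w2 nr wr F0 (fun s _ => cardD X s) Fs
                             G0 (fun t _ => cardD Y t) Gs.
move: sF' tG'; rewrite !inE => /andP[/(subsetP FA) sA dYs] /andP[/(subsetP GB) tB dXt].
(* The common point is outside [Y] because [s] avoids [Y], and outside [X] because [t] avoids [X],
   so it lies in both of the disjoint remainders. *)
have /perm_intersectP[k stk] := cAB s t sA tB.
have es : (k, s k) \in graph s by rewrite inE.
have et : (k, s k) \in graph t by rewrite inE /= stk.
have := disjointFr dst (x := (k, s k)); rewrite !in_setD es et /= !andbT.
by rewrite (disjointFl dXt et) (disjointFl dYs es) => /(_ isT).
Qed.

Lemma uncoveredP r q A s : s \in A -> s \notin uncovered r q A ->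
  exists2 X, X \in cores r q A & X \subset graph s.
Proof.
move=> sA; rewrite inE sA /= negb_forall => /existsP[X].
by rewrite negb_imply negbK => /andP[]; exists X.
Qed.

Lemma card_through2 (a b : 'I_n * 'I_n) : a != b ->
  #|[set s : {perm 'I_n} | [set a; b] \subset graph s]| <= (n - 2)`!.
Proof. by move=> nab; apply: leq_trans (card_graph_superset _) _; rewrite cards2 nab. Qed.

Lemma card_bigcup_le (I T : finType) (P : pred I) (D : I -> {set T}) N :
  (forall i, P i -> #|D i| <= N) -> #|\bigcup_(i | P i) D i| <= #|P| * N.
Proof.
move=> h; rewrite -sum_nat_const; elim/big_rec2: _ => [|i x U Pi IH]; first by rewrite cards0.
by apply: leq_trans (leq_card_setU _ _) (leq_add (h i Pi) IH).
Qed.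

(* If no point lies in all cores of B, a core of A must contain two points, each
   chosen among at most q; so A would have size O((n-2)!). *)
Lemma exists_common_point r q A B :
  (forall X Y, X \in cores r q A -> Y \in cores r q B -> ~~ [disjoint X & Y]) ->
  #|uncovered r q A| + q * (q * (n - 2)`!) < #|A| -> 0 < n ->
  exists z, forall Y, Y \in cores r q B -> z \in Y.
Proof.
move=> cross bigA n0.
have [/existsP[z /forall_inP h]|] := boolP [exists z, [forall Y in cores r q B, z \in Y]].
  by exists z.
rewrite negb_exists => /forallP noz; exfalso.
have {noz} avoid z : {Y | Y \in cores r q B & z \notin Y}.
  have := noz z; rewrite negb_forall => h.
  case: (pickP (fun Y => ~~ ((Y \in cores r q B) ==> (z \in Y)))) => [Y|h0].
    by rewrite negb_imply => /andP[]; exists Y.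
  by exfalso; case/existsP: h => Y; rewrite h0.
(* Any core of [B] supplies the first point [z]; the core chosen to miss [z] supplies the second. *)
have [Y0 Y0B _] := avoid (Ordinal n0, Ordinal n0).
pose U := \bigcup_(z in Y0) \bigcup_(z' in s2val (avoid z))
   [set s : {perm 'I_n} | [set z; z'] \subset graph s].
have coresq Y C : Y \in cores r q C -> #|Y| <= q by rewrite inE => /andP[].
have cU : #|U| <= q * (q * (n - 2)`!).
  apply: (@leq_trans (#|Y0| * (q * (n - 2)`!))); last by rewrite leq_mul2r (coresq _ B) ?orbT.
  apply: card_bigcup_le => z _; case: (avoid z) => Y /= YB zY.
  apply: (@leq_trans (#|Y| * (n - 2)`!)); last by rewrite leq_mul2r (coresq _ B) ?orbT.
  apply: card_bigcup_le => z' z'Y; apply: card_through2.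
  by apply: contraNneq zY => ->.
move: bigA; rewrite ltnNge => /negP; apply.
apply: (@leq_trans #|uncovered r q A :|: U|); last first.
  by apply: leq_trans (leq_card_setU _ _) _; rewrite leq_add2l.
apply/subset_leq_card/subsetP => s sA; rewrite inE.
have [//|su] := boolP (s \in uncovered r q A); have [X XA Xs] := uncoveredP sA su.
have /pred0Pn[z /andP[/= zX zY0]] := cross X Y0 XA Y0B.
apply/bigcupP; exists z => //; case: (avoid z) => Y /= YB zY.
have /pred0Pn[z' /andP[/= z'X z'Y]] := cross X Y XA YB.
apply/bigcupP; exists z' => //; rewrite inE subUset !sub1set.
by rewrite !(subsetP Xs).
Qed.

(** If a core [X] of [A] missed [z], each covered member of [B] would contain [z] and one of the at
    most [q] points of [X]. *)
Lemma common_point_transfer r q A B z :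
  (forall X Y, X \in cores r q A -> Y \in cores r q B -> ~~ [disjoint X & Y]) ->
  #|uncovered r q B| + q * (n - 2)`! < #|B| ->
  (forall Y, Y \in cores r q B -> z \in Y) ->
  forall X, X \in cores r q A -> z \in X.
Proof.
move=> cross bigB zB X XA; apply: contraT => zX.
move: bigB; rewrite ltnNge => /negP; case.
pose U := \bigcup_(z' in X) [set s : {perm 'I_n} | [set z; z'] \subset graph s].
have cU : #|U| <= q * (n - 2)`!.
  apply: (@leq_trans (#|X| * (n - 2)`!)); last first.
    by rewrite leq_mul2r; move: XA; rewrite inE => /andP[-> _]; rewrite orbT.
  apply: card_bigcup_le => z' z'X; apply: card_through2.
  by apply: contraNneq zX => ->.
apply: (@leq_trans #|uncovered r q B :|: U|); last first.
  by apply: leq_trans (leq_card_setU _ _) _; rewrite leq_add2l.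
apply/subset_leq_card/subsetP => s sB; rewrite inE.
have [//|su] := boolP (s \in uncovered r q B); have [Y YB Ys] := uncoveredP sB su.
have /pred0Pn[z' /andP[/= z'X z'Y]] := cross X Y XA YB.
apply/bigcupP; exists z' => //; rewrite inE subUset !sub1set.
by rewrite !(subsetP Ys) // zB.
Qed.

Lemma outside_coset_uncovered r q A (i j : 'I_n) :
  (forall X, X \in cores r q A -> (i, j) \in X) ->
  A :\: one_coset i j \subset uncovered r q A.
Proof.
move=> zA; apply/subsetP => s; rewrite in_setD => /andP[sij sA].
apply: contraT => /(uncoveredP sA)[X /zA zX /subsetP /(_ _ zX)].
by rewrite inE /=; move: sij; rewrite inE => /negP.
Qed.

End Cores.

(** Take r = 128 m and w = 2 m with m the integer square root of n. By [exp_le_ffact] the last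
    condition follows from 512^x <= m^(x-12), whence 12 = 2 * 6; for x >= 13 this holds as m >=
    512^13 and x <= 13 (x-12). The bound 24 is twice the core size 12. *)
Lemma exists_spread_parameters :
  exists n0, forall n, n0 <= n -> exists r w,
    [/\ 2 < w, 64 * n <= r * w, 64 * w <= r, 24 <= r &
        forall x, 12 < x <= n -> r ^ x * (n - x)`! * n ^ 6 <= n`!].
Proof.
(* 512 is the 4 of [exp_le_ffact] times the 128 in [r]; it stays abstract so that its powers are not
   evaluated. *)
have [K KE] : exists K, K = 512 by exists 512.
have K0 : 1 < K by rewrite KE.
exists ((K ^ 13) ^ 2) => n nK.
have [m [mn nm Km]] : exists m, [/\ m ^ 2 <= n, n <= 4 * m ^ 2 & K ^ 13 <= m].
  have exP : exists m, m ^ 2 <= n by exists 0.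
  have bound m : m ^ 2 <= n -> m <= n by case: m => // m; nia.
  case: (ex_maxnP exP bound) => m mn mmax; exists m; split=> //; last exact: mmax.
  have m1 : 0 < m by apply: leq_trans (mmax _ nK); rewrite expn_gt0 ltnW.
  by rewrite leqNgt; apply/negP => nm; have := mmax m.+1; nia.
have m2 : 1 < m by apply: leq_trans Km; rewrite -(exp1n 13) ltn_exp2r.
exists (128 * m), (2 * m); split; try nia.
move=> x /andP[x12 xn].
rewrite -(ffact_fact xn) -mulnA [_ * n ^ 6]mulnC mulnA leq_mul2r; apply/orP; right.
rewrite -(leq_pmul2l (m := 4 ^ x)) ?expn_gt0 //; apply: leq_trans (exp_le_ffact xn).
have x6 : 6 <= x by lia.
have -> : n ^ x = n ^ 6 * n ^ (x - 6) by rewrite -expnD subnKC.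
rewrite mulnA mulnC leq_pmul2l ?expn_gt0; last by nia.
rewrite -expnMn (_ : 4 * (128 * m) = K * m); last by rewrite KE; ring.
apply: (@leq_trans ((m ^ 2) ^ (x - 6))); last by rewrite leq_exp2r // subn_gt0; lia.
rewrite -expnM (_ : 2 * (x - 6) = (x - 12) + x); last by lia.
rewrite expnD expnMn leq_mul2r; apply/orP; right.
apply: (@leq_trans ((K ^ 13) ^ (x - 12))); last by rewrite leq_exp2r // subn_gt0.
by rewrite -expnM leq_exp2l //; lia.
Qed.

(** * Cross-intersecting families close to a 1-coset *)

Section Extremal.
Variable n : nat.
Implicit Types (A B : {set {perm 'I_n}}) (i j : 'I_n) (s t : {perm 'I_n}).

Definition coset_meet i j t : {set {perm 'I_n}} :=
  [set s : {perm 'I_n} | (s i == j) && perm_intersect s t].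

Lemma coset_inter_sub A B i j t :
  cross_intersecting A B -> t \in B -> A :&: one_coset i j \subset coset_meet i j t.
Proof.
by move=> cAB tB; apply/subsetP => s; rewrite !inE => /andP[sA ->]; rewrite cAB.
Qed.

(** Inside the coset, members of [A] meet both [t1] and [t2], which costs at least (n-6)! elements
    against meeting [t1] alone; this pays for the members of [A] outside. *)
Lemma two_outside_small A B i j t1 t2 :
  5 < n -> cross_intersecting A B -> #|A :\: one_coset i j| <= (n - 6)`! ->
  t1 \in B -> t2 \in B -> t1 != t2 -> t1 i != j -> t2 i != j ->
  #|A| <= n.-1`! - derangements n.-1 - derangements n.-2.
Proof.
move=> n5 cAB Aout t1B t2B nt t1ij t2ij.
rewrite -(card_coset_meet t1ij) -/(coset_meet i j t1) -(cardsID (one_coset i j) A).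
rewrite -(cardsID (coset_meet i j t2) (coset_meet i j t1)).
apply: leq_add.
  by rewrite subset_leq_card // subsetI !(coset_inter_sub _ _ cAB).
apply: leq_trans Aout _; rewrite eq_sym in nt.
apply: leq_trans (card_coset_disjoint_meet n5 nt t2ij t1ij) _.
apply/subset_leq_card/subsetP => s; rewrite !inE.
by case/and3P=> -> /negbTE -> ->.
Qed.

Lemma extremal_outside A B i j :
  5 < n -> cross_intersecting A B ->
  ~ (exists i j : 'I_n, A \subset one_coset i j /\ B \subset one_coset i j) ->
  n.-1`! - derangements n.-1 - derangements n.-2 < #|A| ->
  n.-1`! - derangements n.-1 - derangements n.-2 < #|B| ->
  #|A :\: one_coset i j| <= (n - 6)`! ->
  exists2 t : {perm 'I_n}, t i != j & B :\: one_coset i j = [set t].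
Proof.
move=> n5 cAB nAB bigA bigB Aout.
have cBA : cross_intersecting B A by move=> s t sB tA; rewrite perm_intersectC cAB.
have [B0|[t tB]] := set_0Vmem (B :\: one_coset i j).
  (* If [B] lies in the coset, a member [s] of [A] outside it would confine [B] to the coset members
     meeting [s], against [bigB]. *)
  case: nAB; exists i, j.
  have BC : B \subset one_coset i j by rewrite -setD_eq0 B0.
  split=> //; apply: contraTT bigB => /subsetPn[s sA sij]; rewrite -leqNgt.
  rewrite inE in sij; rewrite -(card_coset_meet sij) subset_leq_card //.
  by rewrite -{1}(setIidPl BC) (coset_inter_sub _ _ cBA).
exists t; first by move: tB; rewrite !inE => /andP[].
apply/setP => u; rewrite in_set1; apply/idP/eqP => [uB|-> //].
apply: contraTeq bigA => nut; rewrite -leqNgt.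
move: tB uB; rewrite !inE => /andP[tij tB] /andP[uij uB].
exact: two_outside_small cAB Aout uB tB nut uij tij.
Qed.

(** The part of [A] in the coset sits in [coset_meet i j t], and the lower bound on [#|A|] leaves no
    room for a gap. *)
Lemma extremal_shape A B i j s t :
  cross_intersecting A B -> A :\: one_coset i j = [set s] -> t \in B -> t i != j ->
  n.-1`! - derangements n.-1 - derangements n.-2 < #|A| ->
  A = coset_meet i j t :|: [set s].
Proof.
move=> cAB As tB tij bigA.
rewrite -(setID A (one_coset i j)) As; congr (_ :|: _); apply/eqP.
rewrite eqEcard (coset_inter_sub _ _ cAB) // card_coset_meet //.
by move: bigA; rewrite -(cardsID (one_coset i j) A) As cards1 addn1 ltnS.
Qed.

Lemma extremal_structure r w A B :
  2 < w -> 64 * n <= r * w -> 64 * w <= r -> 24 <= r -> 292 <= n ->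
  (forall x, 12 < x <= n -> r ^ x * (n - x)`! * n ^ 6 <= n`!) ->
  cross_intersecting A B ->
  ~ (exists i j : 'I_n, A \subset one_coset i j /\ B \subset one_coset i j) ->
  n.-1`! - derangements n.-1 - derangements n.-2 < #|A| ->
  n.-1`! - derangements n.-1 - derangements n.-2 < #|B| ->
  exists (i j : 'I_n) (tau rho : {perm 'I_n}),
    [/\ perm_intersect tau rho, tau i != j, rho i != j,
        A = coset_meet i j tau :|: [set rho] & B = coset_meet i j rho :|: [set tau]].
Proof.
move=> w2 nr wr r24 nbig sizes cAB nAB bigA bigB.
have n0 : 0 < n by lia.
have n5 : 5 < n by lia.
have cBA : cross_intersecting B A by move=> s t sB tA; rewrite perm_intersectC cAB.
(* n! is at most n^6 (n-6)!. *)
have unc (D : {set {perm 'I_n}}) : #|uncovered r 12 D| <= (n - 6)`!.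
  rewrite -(leq_pmul2r (m := n ^ 6)) ?expn_gt0 ?n0 //.
  apply: leq_trans (card_uncovered _ sizes) _.
  by rewrite -(ffact_fact n5) mulnC leq_mul2l ffact_le_exp orbT.
(* It suffices that n - 2 >= 2 (12 * 12 + 1) = 290, which is where 292 comes from. *)
have M : 12 * (12 * (n - 2)`!) + (n - 6)`! <= n.-1`! - derangements n.-1 - derangements n.-2.
  have f62 : (n - 6)`! <= (n - 2)`! by apply: leq_fact; lia.
  have := card_coset_meet_lower (n := n); rewrite -muln2.
  move: (n.-1`! - _ - _) (n - 6)`! (n - 2)`! f62 => a b c bc; nia.
have big1 (D : {set {perm 'I_n}}) : n.-1`! - derangements n.-1 - derangements n.-2 < #|D| ->
    #|uncovered r 12 D| + 12 * (12 * (n - 2)`!) < #|D|.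
  move=> h; apply: leq_ltn_trans h; apply: leq_trans M; rewrite addnC leq_add2l; exact: unc.
have cross X Y : X \in cores r 12 A -> Y \in cores r 12 B -> ~~ [disjoint X & Y].
  exact: (cores_cross (q := 12) w2 nr wr isT r24 cAB).
have [[i j] zB] := exists_common_point cross (big1 A bigA) n0.
have zA : forall X, X \in cores r 12 A -> (i, j) \in X.
  apply: (common_point_transfer cross _ zB).
  apply: leq_ltn_trans (big1 B bigB); rewrite leq_add2l; exact: leq_pmull.
have outA := leq_trans (subset_leq_card (outside_coset_uncovered zA)) (unc A).
have outB := leq_trans (subset_leq_card (outside_coset_uncovered zB)) (unc B).
have [tau tij Bt] := extremal_outside n5 cAB nAB bigA bigB outA.
have nBA : ~ (exists i j : 'I_n, B \subset one_coset i j /\ A \subset one_coset i j).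
  by move=> [i' [j' [h1 h2]]]; apply: nAB; exists i', j'.
have [rho rij As] := extremal_outside n5 cBA nBA bigB bigA outB.
have tB : tau \in B by have := set11 tau; rewrite -Bt inE => /andP[].
have rA : rho \in A by have := set11 rho; rewrite -As inE => /andP[].
exists i, j, tau, rho; split=> //; first by rewrite cBA.
- exact: extremal_shape cAB As tB tij bigA.
- exact: extremal_shape cBA Bt rA rij bigB.
Qed.

Lemma card_extremal i j s t :
  s i != j -> t i != j ->
  #|coset_meet i j t :|: [set s]| = n.-1`! - derangements n.-1 - derangements n.-2 + 1.
Proof.
move=> sij tij; rewrite setUC cardsU1 card_coset_meet // inE (negbTE sij) /=.
by rewrite addnC.
Qed.

End Extremal.

Theorem theorem9 : exists n0 : nat, forall n : nat, n0 <= n ->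
  forall A B : {set {perm 'I_n}},
    cross_intersecting A B ->
    ~ (exists i j : 'I_n, A \subset one_coset i j /\ B \subset one_coset i j) ->
    minn #|A| #|B| <= (n.-1)`! - derangements n.-1 - derangements n.-2 + 1 /\
    (minn #|A| #|B| = (n.-1)`! - derangements n.-1 - derangements n.-2 + 1 <->
     exists (i j : 'I_n) (tau rho : {perm 'I_n}),
       [/\ perm_intersect tau rho, tau i != j, rho i != j,
           A = [set s : {perm 'I_n} | (s i == j) && perm_intersect s tau] :|: [set rho] &
           B = [set s : {perm 'I_n} | (s i == j) && perm_intersect s rho] :|: [set tau]]).
Proof.
have [n0 params] := exists_spread_parameters.
exists (n0 + 292) => n nn0 A B cAB nAB.
have [r [w [w2 nr wr r24 sizes]]] := params n (leq_trans (leq_addr _ _) nn0).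
have n292 := leq_trans (leq_addl _ _) nn0.
have shape := extremal_structure w2 nr wr r24 n292 sizes cAB nAB.
rewrite addn1; set M := n.-1`! - _ - _ in shape *.
have eq_of_shape : (exists (i j : 'I_n) (tau rho : {perm 'I_n}),
    [/\ perm_intersect tau rho, tau i != j, rho i != j,
        A = coset_meet i j tau :|: [set rho] & B = coset_meet i j rho :|: [set tau]]) ->
    minn #|A| #|B| = M.+1.
  by move=> [i [j [tau [rho [_ tij rij -> ->]]]]]; rewrite !card_extremal // minnn addn1.
(* A minimum above [M] forces the extremal shape and hence equals [M.+1], which gives both the bound
   and the equality case. *)
have shape_of_ge (h : M < minn #|A| #|B|) :=
  shape (leq_trans h (geq_minl _ _)) (leq_trans h (geq_minr _ _)).
split; last by split=> [e|]; [apply: shape_of_ge; rewrite e | exact: eq_of_shape].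
by have [/leqW|/shape_of_ge/eq_of_shape ->] := leqP (minn #|A| #|B|) M.
Qed.
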